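(* Let $\mathfrak g$ be a restricted Lie algebra over $\mathbb F$ and $M$ a restricted $\mathfrak g$-module. With $\delta^0:C^0(\mathfrak g;M)\to C^1(\mathfrak g;M)$ and $\delta^1:C^1(\mathfrak g;M)\to C^2(\mathfrak g;M)$ as defined in the context, $\delta^1\delta^0=0$, and $H^1(\mathfrak g;M)=\ker\delta^1/\operatorname{im}\delta^0$ injects (by sending the class of a cocycle $\psi$ to its ordinary cohomology class) as a subspace of the ordinary Lie algebra cohomology space $H^1_{\rm cl.}(\mathfrak g;M)$.
   Context: $\mathbb F$ is a field of characteristic $p>0$. Left-normed brackets: $[g_1,g_2,\dots,g_k]=[[\cdots[[g_1,g_2],g_3]\cdots],g_k]$. A restricted Lie algebra is a Lie algebra $\mathfrak g$ over $\mathbb F$ with a map $g\mapsto g^{[p]}$ such that $(\lambda g)^{[p]}=\lambda^pg^{[p]}$; $(g+h)^{[p]}=g^{[p]}+h^{[p]}+\sum\frac1{\#(g)}[g_1,\dots,g_p]$, the sum over words $(g_1,\dots,g_p)$ in the letters $g,h$ with $g_1=g$, $g_2=h$, where $\#(g)$ is the number of letters $g$ in the word; and $[g,h^{[p]}]=[g,h,\dots,h]$ ($p$ copies of $h$). A restricted $\mathfrak g$-module is a $\mathfrak g$-module $M$ with $g^{[p]}x=g^px$ for all $g,x$. Ordinary (classical) cochains: $C^q_{\rm cl.}(\mathfrak g;M)=\operatorname{Hom}_{\mathbb F}(\Lambda^q\mathfrak g,M)$, with $\delta_{\rm cl.}(m)(g)=-gm$ for $m\in M=C^0_{\rm cl.}$,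 and $\delta_{\rm cl.}\psi(g,h)=-g\psi(h)+h\psi(g)+\psi([g,h])$ for $\psi\in C^1_{\rm cl.}$; $H^1_{\rm cl.}(\mathfrak g;M)$ is the resulting cohomology in degree 1. Restricted cochains: $C^0(\mathfrak g;M)=C^0_{\rm cl.}(\mathfrak g;M)=M$, $C^1(\mathfrak g;M)=C^1_{\rm cl.}(\mathfrak g;M)=\operatorname{Hom}_{\mathbb F}(\mathfrak g,M)$, $\delta^0=\delta^0_{\rm cl.}$. For $\varphi\in C^2_{\rm cl.}(\mathfrak g;M)$, a map $\omega:\mathfrak g\to M$ has the $*$-property with respect to $\varphi$ if for all $\lambda\in\mathbb F$, $g,h\in\mathfrak g$: (i) $\omega(\lambda g)=\lambda^p\omega(g)$; (ii) $$\omega(g+h)=\omega(g)+\omega(h)+\sum_{\substack{g_j=g\text{ or }h\\ g_1=g,\,g_2=h}}\frac1{\#(g)}\sum_{k=0}^{p-2}(-1)^kg_p\cdots g_{p-k+1}\varphi([g_1,\dots,g_{p-k-1}],g_{p-k}).$$ $C^2(\mathfrak g;M)$ is the space of pairs $(\varphi,\omega)$ with $\varphi\in C^2_{\rm cl.}(\mathfrak g;M)$ and $\omega$ having the $*$-property with respect to $\varphi$, with pointwise operations in each coordinate. For $\psi\in C^1(\mathfrak g;M)$ let $\tilde\psi(g)=\psi(g^{[p]})-g^{p-1}\psi(g)$; this has the $*$-property with respect to $\delta_{\rm cl.}\psi$, and $\delta^1\psi=(\delta_{\rm cl.}\psi,\tilde\psi)$. *)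

(* Defs.v *)
From HB Require Import structures.
From mathcomp Require Import all_boot all_order all_algebra.
From mathcomp Require Import ring_quotient generic_quotient.
From mathcomp Require Import boolp functions.

Set Implicit Arguments.
Unset Strict Implicit.
Unset Printing Implicit Defensive.

Import GRing.Theory.
Local Open Scope ring_scope.
Local Open Scope quotient_scope.

Section LinearMaps.
Variables (R : comNzRingType) (U V : lmodType R).
Implicit Types (f g h : {linear U -> V}) (a b : R).

HB.instance Definition _ := gen_eqMixin {linear U -> V}.
HB.instance Definition _ := gen_choiceMixin {linear U -> V}.

Lemma linear_ext f g : f =1 g -> f = g.
Proof.
case: f g => [f cf] [g cg] /= /funext fg; case: _ / fg cg => cg.
congr GRing.Linear.Pack; case: cf cg => [[a1] [s1]] [[a2] [s2]].
by rewrite (Prop_irrelevance a1 a2) (Prop_irrelevance s1 s2).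
Qed.

Definition lin_add f g : {linear U -> V} := f \+ g.
Definition lin_opp f : {linear U -> V} := \- f.
Definition lin_scale a f : {linear U -> V} := a \*: f.

Fact lin_addA : associative lin_add.
Proof. by move=> f g h; apply: linear_ext => x /=; rewrite addrA. Qed.
Fact lin_addC : commutative lin_add.
Proof. by move=> f g; apply: linear_ext => x /=; rewrite addrC. Qed.
Fact lin_add0 : left_id (\0 : {linear U -> V}) lin_add.
Proof. by move=> f; apply: linear_ext => x /=; rewrite add0r. Qed.
Fact lin_addN : left_inverse (\0 : {linear U -> V}) lin_opp lin_add.
Proof. by move=> f; apply: linear_ext => x /=; rewrite addNr. Qed.

HB.instance Definition _ := GRing.isZmodule.Build {linear U -> V}
  lin_addA lin_addC lin_add0 lin_addN.

Fact lin_scaleA a b f : lin_scale a (lin_scale b f) = lin_scale (a * b) f.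
Proof. by apply: linear_ext => x /=; rewrite scalerA. Qed.
Fact lin_scale1 : left_id 1 lin_scale.
Proof. by move=> f; apply: linear_ext => x /=; rewrite scale1r. Qed.
Fact lin_scaleDr : right_distributive lin_scale +%R.
Proof. by move=> a f g; apply: linear_ext => x /=; rewrite scalerDr. Qed.
Fact lin_scaleDl f : {morph lin_scale^~ f : a b / a + b}.
Proof. by move=> a b; apply: linear_ext => x /=; rewrite scalerDl. Qed.

HB.instance Definition _ := GRing.Zmodule_isLmodule.Build R {linear U -> V}
  lin_scaleA lin_scale1 lin_scaleDr lin_scaleDl.
End LinearMaps.

(* The cohomology ker d' / im d at B of A --d--> B --d'--> C.  The relation
   d' \o d = 0 is not required: one divides ker d' by ker d' :&: im d, which is
   im d whenever d' \o d = 0. *)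
Section Cohomology.
Variables (R : comNzRingType) (A B C : lmodType R).
Variables (d : {linear A -> B}) (d' : {linear B -> C}).

Definition cocycle_pred : {pred B} := fun x => d' x == 0.

Fact cocycle_pred_closed : submod_closed cocycle_pred.
Proof.
split=> [|a x y]; rewrite /cocycle_pred !unfold_in ?linear0 // linearP.
by move=> /eqP-> /eqP->; rewrite scaler0 addr0.
Qed.
HB.instance Definition _ :=
  GRing.isSubmodClosed.Build R B cocycle_pred cocycle_pred_closed.

Record cocycle := Cocycle { cocycle_val : B; _ : cocycle_val \in cocycle_pred }.
HB.instance Definition _ := [isSub for cocycle_val].
HB.instance Definition _ := [Choice of cocycle by <:].
HB.instance Definition _ := [SubChoice_isSubLmodule of cocycle by <:].

Definition coboundary_pred : {pred cocycle} :=
  fun z => `[< exists x, d x = val z >].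

Fact coboundary_pred_closed : submod_closed coboundary_pred.
Proof.
split=> [|a u v]; rewrite !unfold_in.
  by apply/asboolP; exists 0; rewrite !linear0.
move=> /asboolP[x du] /asboolP[y dv]; apply/asboolP.
by exists (a *: x + y); rewrite !linearP du dv.
Qed.
HB.instance Definition _ :=
  GRing.isSubmodClosed.Build R cocycle coboundary_pred coboundary_pred_closed.

Definition cohomology := Quotient.quot coboundary_pred.
HB.instance Definition _ := GRing.Zmodule.on cohomology.

Definition coh_class (z : cocycle) : cohomology := \pi_cohomology z.

Lemma coh_classP z z' :
  coh_class z = coh_class z' <-> exists x, d x = val z - val z'.
Proof.
have -> : (exists x, d x = val z - val z') = (z - z' \in coboundary_pred).
  by rewrite unfold_in asboolE raddfB.
rewrite /coh_class Quotient.idealrBE.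
by split=> [/eqP|/eqP].
Qed.

Lemma coh_classD : {morph coh_class : z z' / z + z'}.
Proof. by move=> z z'; rewrite /coh_class [LHS]raddfD. Qed.

Definition coh_scale (a : R) (u : cohomology) : cohomology :=
  coh_class (a *: repr u).

Lemma coh_scaleE a z : coh_scale a (coh_class z) = coh_class (a *: z).
Proof.
apply/coh_classP; have /coh_classP[x dx] : coh_class (repr (coh_class z)) = coh_class z by exact: reprK.
by exists (a *: x); rewrite linearZ /= dx scalerBr.
Qed.

Lemma coh_ind (P : cohomology -> Prop) : (forall z, P (coh_class z)) -> forall u, P u.
Proof. by move=> Pz u; rewrite -[u]reprK; exact: Pz. Qed.

Fact coh_scaleA a b u : coh_scale a (coh_scale b u) = coh_scale (a * b) u.
Proof. by elim/coh_ind: u => z; rewrite !coh_scaleE scalerA. Qed.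
Fact coh_scale1 : left_id 1 coh_scale.
Proof. by elim/coh_ind => z; rewrite coh_scaleE scale1r. Qed.
Fact coh_scaleDr : right_distributive coh_scale +%R.
Proof.
move=> a; elim/coh_ind => z; elim/coh_ind => z'.
by rewrite -coh_classD !coh_scaleE scalerDr coh_classD.
Qed.
Fact coh_scaleDl u : {morph coh_scale^~ u : a b / a + b}.
Proof.
move=> a b; elim/coh_ind: u => z.
by rewrite !coh_scaleE scalerDl coh_classD.
Qed.

HB.instance Definition _ := GRing.Zmodule_isLmodule.Build R cohomology
  coh_scaleA coh_scale1 coh_scaleDr coh_scaleDl.

Fact coh_class_linear : linear coh_class.
Proof. by move=> a z z'; rewrite coh_classD -coh_scaleE. Qed.
HB.instance Definition _ :=
  GRing.isLinear.Build R cocycle cohomology *:%R coh_class coh_class_linear.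
End Cohomology.

(* A word (g_1, ..., g_p) in two letters g, h is encoded by the p-tuple of
   booleans recording which of its letters are g (true) or h (false); the
   constraint on take 2 says g_1 = g and g_2 = h, and count id w = #(g), which
   lies in [1, p - 1] and so is invertible when F has characteristic p. *)
Section Words.
Variables (F : fieldType) (p : nat).

Definition word_sum (V : lmodType F) (f : seq bool -> V) : V :=
  \sum_(w : p.-tuple bool | take 2 w == [:: true; false])
     (count id w)%:R^-1 *: f w.
End Words.

Definition letters (T : Type) (x y : T) (w : seq bool) : seq T :=
  [seq if b then x else y | b <- w].

(* Jacobson's formula for (a + b)^p in an associative ring of characteristic p,
   used below to show that delta1 takes its values in C2. *)
Section Jacobson.
Variable R : nzRingType.
Implicit Types (a b c : R).
Definition ring_lie (S : nzRingType) (x y : S) := x * y - y * x.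

Lemma mulr_signCA (S : nzRingType) (y z : S) n :
  y * ((-1) ^+ n * z) = (-1) ^+ n * (y * z).
Proof. by rewrite mulrA commr_sign mulrA. Qed.

Lemma iter_comm (S : nzRingType) (y c : S) n :
  iter n (@ring_lie S ^~ y) c =
  \sum_(j < n.+1) (-1) ^+ j * (y ^+ j * c * y ^+ (n - j)) *+ 'C(n, j).
Proof.
elim: n => [|n IH].
  by rewrite big_ord1 /= bin0 subnn !expr0 !mul1r mulr1.
rewrite iterS IH /ring_lie mulr_suml mulr_sumr.
rewrite big_ord_recl [X in _ - X]big_ord_recr [RHS]big_ord_recl [X in _ = _ + X]big_ord_recr /=.
rewrite !bin0 !binn !subn0 !subnn !expr0 !mulr1 !mul1r.
rewrite opprD -addrA -[c * _ * _]mulrA -exprSr; congr (_ + _).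
rewrite addrA; congr (_ + _).
  rewrite -sumrN -big_split /=; apply: eq_bigr => j _.
  rewrite /bump /= add1n binS mulrnDr mulrnAl mulrnAr.
  rewrite subSS -!mulrA -exprSr subnSK // addrC [in RHS]addrC; congr (_ + _).
  by rewrite mulr_signCA !exprS mulN1r mulNr mulNrn !mulrA.
by rewrite /bump add1n !mulr1n mulr_signCA !exprS mulN1r mulNr !mulrA.
Qed.

Lemma deriv_exp_comm (S : nzRingType) (q : {poly S}) n :
  (q ^+ n)^`() = \sum_(j < n) q ^+ j * q^`() * q ^+ (n.-1 - j).
Proof.
elim: n => [|n IH]; first by rewrite big_ord0 expr0 derivC.
rewrite exprS derivM IH big_ord_recl expr0 mul1r subn0; congr (_ + _).
rewrite mulr_sumr; apply: eq_bigr => j _.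
rewrite /= /bump add1n exprS !mulrA.
by case: n {IH} j => [[]//|n] j; rewrite subSS.
Qed.

Variables (p : nat) (charp : p \in [pchar R]) (a b : R).

Let p_pr : prime p := pcharf_prime charp.

Lemma natr_bin_pchar j : (j < p)%N -> (-1) ^+ j * 'C(p.-1, j)%:R = 1 :> {poly R}.
Proof.
have p_gt0 := prime_gt0 p_pr.
elim: j => [|j IH] ltj; first by rewrite bin0 mulr1.
have E : ('C(p.-1, j.+1) + 'C(p.-1, j))%:R = 0 :> {poly R}.
  rewrite -binS prednK //; have [k ->] := dvdnP (prime_dvd_bin p_pr (ltj : 0 < j.+1 < p)%N).
  by rewrite natrM -[p%:R]polyC_natr (pcharf0 charp) polyC0 mulr0.
rewrite natrD in E; have /eqP := E; rewrite addr_eq0 => /eqP ->.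
by rewrite exprS mulrN mulN1r mulNr opprK IH // ltnW.
Qed.

Let q : {poly R} := a%:P * 'X + b%:P.

Lemma deriv_q : q^`() = a%:P.
Proof. by rewrite derivD derivM !derivC mul0r derivX mulr1 add0r addr0. Qed.

Lemma deriv_qp : (q ^+ p)^`() = iter p.-1 (@ring_lie _ ^~ q) a%:P.
Proof.
have p_gt0 := prime_gt0 p_pr.
rewrite iter_comm deriv_exp_comm prednK //; apply: eq_bigr => j _.
rewrite deriv_q -mulr_natr -[RHS]mulrA (commr_nat (_ * _) 'C(p.-1, j)) [RHS]mulrA.
by rewrite natr_bin_pchar ?mul1r // -(prednK p_gt0).
Qed.

Lemma sum_tuple0 (V : nmodType) (f : seq bool -> V) :
  \sum_(w : 0.-tuple bool) f w = f [::].
Proof. by rewrite (big_pred1 [tuple]) // => w; apply/esym/eqP; exact: tuple0. Qed.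

Lemma sum_tupleS (V : nmodType) n (f : seq bool -> V) :
  \sum_(w : n.+1.-tuple bool) f w =
  \sum_(w : n.-tuple bool) f (true :: w) + \sum_(w : n.-tuple bool) f (false :: w).
Proof.
rewrite (reindex (fun xw : bool * n.-tuple bool => [tuple of xw.1 :: xw.2])) /=.
  by rewrite -(pair_bigA _ (fun x (w : n.-tuple bool) => f (x :: w))) big_bool.
exists (fun w => (thead w, [tuple of behead w])) => [[x w] _|w _] /=.
  by rewrite theadE; congr pair; exact: val_inj.
by rewrite [RHS]tuple_eta; exact: val_inj.
Qed.

Lemma comm_mulX (u v r : {poly R}) :
  ring_lie (u * 'X + v) r = ring_lie u r * 'X + ring_lie v r.
Proof.
by rewrite /ring_lie mulrDr mulrDl opprD addrACA mulrBl -!mulrA -(commr_polyX r).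
Qed.

Lemma iter_comm_word n c : iter n (@ring_lie _ ^~ q) c%:P =
  \sum_(w : n.-tuple bool)
    (foldl (@ring_lie R) c (letters a b w))%:P * 'X^(count id w).
Proof.
elim: n c => [|n IH] c.
  by rewrite (sum_tuple0 (fun w => (foldl (@ring_lie R) c (letters a b w))%:P * 'X^(count id w))) expr0 mulr1.
rewrite iterSr (sum_tupleS _ (fun w => (foldl (@ring_lie R) c (letters a b w))%:P * 'X^(count id w))) /=.
rewrite -IH; under eq_bigr do rewrite add1n exprSr mulrA; rewrite -mulr_suml -IH.
have -> : ring_lie c%:P q = (ring_lie c a)%:P * 'X + (ring_lie c b)%:P.
  rewrite /ring_lie /q mulrDr mulrDl opprD addrACA !polyCB !polyCM; congr (_ + _).
  by rewrite mulrBl !mulrA -[_ * 'X * _]mulrA -commr_polyX !mulrA.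
elim: n (ring_lie c a)%:P (ring_lie c b)%:P {IH} => //= n IH u v.
by rewrite IH comm_mulX.
Qed.

Lemma coef_qn0 n : (q ^+ n)`_0 = b ^+ n.
Proof.
elim: n => [|n IH]; first by rewrite !expr0 coef1.
by rewrite !exprS coef0M IH coefD coefMX eqxx add0r coefC.
Qed.

Lemma coef_qn n : (q ^+ n)`_n = a ^+ n /\ (size (q ^+ n) <= n.+1)%N.
Proof.
elim: n => [|n [IH sz]]; first by rewrite !expr0 coef1 size_poly1.
have E : q ^+ n.+1 = a%:P * q ^+ n * 'X + b%:P * q ^+ n.
  by rewrite exprS /q mulrDl -!mulrA -commr_polyX.
split.
  by rewrite E coefD coefMX !coefCM IH exprS [X in b * X]nth_default // mulr0 addr0.
apply/leq_sizeP => j ltj; rewrite E coefD coefMX !coefCM.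
case: j ltj => // j ltj; rewrite /= !nth_default ?mulr0 ?addr0 //.
  exact: leq_trans sz (ltnW ltj).
exact: leq_trans sz ltj.
Qed.

Lemma jacobson : exists P : nat -> R,
  (a + b) ^+ p = a ^+ p + b ^+ p + \sum_(1 <= i < p) P i /\
  forall i, (0 < i < p)%N -> P i *+ i =
    \sum_(w : p.-tuple bool | (take 2 w == [:: true; false]) && (count id w == i))
      (if letters a b w is c :: s then foldl (@ring_lie R) c s else 0).
Proof.
have p_gt1 := prime_gt1 p_pr; have p_gt0 := prime_gt0 p_pr.
exists (fun i => (q ^+ p)`_i); split.
  have [qp sz] := coef_qn p; rewrite -qp -(coef_qn0 p).
  have -> : (a + b) ^+ p = (q ^+ p).[1].
    rewrite horner_exp_comm; last by rewrite /comm_poly mulr1 mul1r.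
    by rewrite /q hornerD hornerMX !hornerC mulr1.
  rewrite (horner_coef_wide _ sz).
  under eq_bigr do rewrite expr1n mulr1.
  rewrite -(big_mkord xpredT (fun i => (q ^+ p)`_i)) big_nat_recr //= big_ltn //.
  by rewrite addrC addrA.
move=> [|i] // /andP[_ ltip].
rewrite -coef_deriv deriv_qp iter_comm_word coef_sum.
have [n pE] : exists n, p = n.+2 by exists p.-2; rewrite !prednK // -subn1 subn_gt0.
pose f w := if (take 2 w == [:: true; false]) && (count id w == i.+1) then
      (if letters a b w is c :: s then foldl (@ring_lie R) c s else 0) else 0.
rewrite [RHS]big_mkcond -[RHS]/(\sum_(w : p.-tuple bool) f w) pE [RHS](sum_tupleS _ f).
rewrite [X in _ = _ + X]big1 ?addr0; last by [].
rewrite (sum_tupleS _ (fun w => ((foldl (@ring_lie R) a (letters a b w))%:P * 'X^(count id w))`_i)).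
rewrite (sum_tupleS _ (fun w => f (true :: w))) /f /=.
congr (_ + _).
  rewrite !big1 // => w _; rewrite /ring_lie subrr.
  have -> : foldl (@ring_lie R) 0 (letters a b w) = 0.
    by elim: (letters a b w) => //= x s IH; rewrite /ring_lie mul0r mulr0 subrr.
  by rewrite mul0r coef0.
apply: eq_bigr => w _; rewrite take0 eqxx /= !add0n add1n eqSS coefCM coefXn eq_sym.
by case: eqP; rewrite ?mulr1 ?mulr0.
Qed.
End Jacobson.

HB.mixin Record isLieAlgebra (F : fieldType) L of GRing.Lmodule F L := {
  lie : L -> L -> L;
  lie_linearl : forall y, linear (lie^~ y);
  lie_linearr : forall x, linear (lie x);
  liexx : forall x, lie x x = 0;
  lie_jacobi : forall x y z,
    lie x (lie y z) + lie y (lie z x) + lie z (lie x y) = 0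
}.

#[short(type="lieAlgType")]
HB.structure Definition LieAlgebra (F : fieldType) :=
  { L of GRing.Lmodule F L & isLieAlgebra F L }.

Definition lie_word (F : fieldType) (L : lieAlgType F) (s : seq L) : L :=
  if s is x :: s' then foldl lie x s' else 0.

HB.mixin Record isRestricted (F : fieldType) (p : nat) L of LieAlgebra F L := {
  ppow : L -> L;
  ppowZ : forall (a : F) x, ppow (a *: x) = a ^+ p *: ppow x;
  ppowD : forall x y, ppow (x + y) =
    ppow x + ppow y + word_sum p (fun w => lie_word (letters x y w));
  lie_ppow : forall x y, lie x (ppow y) = iter p (lie^~ y) x
}.

#[short(type="restrictedLieAlgType")]
HB.structure Definition RestrictedLieAlgebra (F : fieldType) (p : nat) :=
  { L of LieAlgebra F L & isRestricted F p L }.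

HB.mixin Record isLieModule (F : fieldType) (L : lieAlgType F) M
    of GRing.Lmodule F M := {
  act : L -> M -> M;
  act_linearl : forall m, linear (act^~ m);
  act_linearr : forall x, linear (act x);
  act_lie : forall x y m, act (lie x y) m = act x (act y m) - act y (act x m)
}.

#[short(type="lieModType")]
HB.structure Definition LieModule (F : fieldType) (L : lieAlgType F) :=
  { M of GRing.Lmodule F M & isLieModule F L M }.

HB.mixin Record isRestrictedModule (F : fieldType) (p : nat)
    (L : restrictedLieAlgType F p) M of LieModule F L M := {
  act_ppow : forall (x : L) (m : M), act (ppow x) m = iter p (act x) m
}.

#[short(type="restrictedModType")]
HB.structure Definition RestrictedModule (F : fieldType) (p : nat)
    (L : restrictedLieAlgType F p) :=
  { M of LieModule F L M & isRestrictedModule F p L M }.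

Section Classical.
Variables (F : fieldType) (L : lieAlgType F) (M : lieModType L).
Implicit Types (f : L -> L -> M) (psi : {linear L -> M}).

HB.instance Definition _ (x : L) :=
  GRing.isLinear.Build F M M *:%R (act x) (act_linearr x).

Lemma actDl (x y : L) (m : M) : act (x + y) m = act x m + act y m.
Proof. by have := act_linearl m 1 x y; rewrite !scale1r. Qed.

Lemma actZl a (x : L) (m : M) : act (a *: x) m = a *: act x m.
Proof.
have act0 : act (0 : L) m = 0 by apply: (addrI (act 0 m)); rewrite -actDl !addr0.
by have := act_linearl m a x 0; rewrite act0 !addr0.
Qed.

Definition alternating_bilinear f :=
  [/\ forall y, linear (f^~ y), forall x, linear (f x) & forall x, f x x = 0].

Definition alternating_pred : {pred L -> L -> M} :=
  fun f => `[< alternating_bilinear f >].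

Fact alternating_pred_closed : submod_closed alternating_pred.
Proof.
split=> [|a f f']; rewrite !unfold_in.
  by apply/asboolP; split=> [y b x x'|x b y y'|x] //=; rewrite scaler0 addr0.
have E x y : (a *: f + f') x y = a *: f x y + f' x y by [].
move=> /asboolP[fl fr fa] /asboolP[fl' fr' fa']; apply/asboolP.
split=> [y b x x'|x b y y'|x] /=; rewrite !E.
- by rewrite fl fl' !scalerDr !scalerA mulrC addrACA.
- by rewrite fr fr' !scalerDr !scalerA mulrC addrACA.
- by rewrite fa fa' scaler0 addr0.
Qed.
HB.instance Definition _ :=
  GRing.isSubmodClosed.Build F (L -> L -> M) alternating_pred
    alternating_pred_closed.

(* Hom_F(Lambda^2 L, M), as alternating bilinear maps. *)
Record C2cl :=
  MkC2cl { C2cl_val :> L -> L -> M; _ : C2cl_val \in alternating_pred }.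
HB.instance Definition _ := [isSub for C2cl_val].
HB.instance Definition _ := [Choice of C2cl by <:].
HB.instance Definition _ := [SubChoice_isSubLmodule of C2cl by <:].

(* The restricted cochains in degrees 0 and 1 are the ordinary ones, M and
   {linear L -> M}, and delta0 serves both complexes. *)
Definition delta0_fun (m : M) (x : L) : M := - act x m.

Fact delta0_fun_linear m : linear (delta0_fun m).
Proof. by move=> a x y; rewrite /delta0_fun act_linearl opprD scalerN. Qed.
HB.instance Definition _ m :=
  GRing.isLinear.Build F L M *:%R (delta0_fun m) (delta0_fun_linear m).

Definition delta0 (m : M) : {linear L -> M} := delta0_fun m.

Fact delta0_linear : linear delta0.
Proof.
move=> a m m'; apply: linear_ext => x.
by rewrite /= /delta0_fun act_linearr opprD scalerN.
Qed.
HB.instance Definition _ :=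
  GRing.isLinear.Build F M {linear L -> M} *:%R delta0 delta0_linear.

Definition delta1cl_fun psi (x y : L) : M :=
  - act x (psi y) + act y (psi x) + psi (lie x y).

Lemma lie_anti (x y : L) : lie y x = - lie x y.
Proof.
have := liexx (x + y); have := lie_linearl (x + y) 1 x y.
rewrite !scale1r => -> ; have := lie_linearr x 1 x y; have := lie_linearr y 1 x y.
rewrite !scale1r => -> ->; rewrite !liexx add0r addr0 addrC.
by move/eqP; rewrite addr_eq0 => /eqP.
Qed.

Fact delta1cl_subproof psi : delta1cl_fun psi \in alternating_pred.
Proof.
rewrite unfold_in; apply/asboolP.
have H y : linear ((delta1cl_fun psi)^~ y).
  move=> a x x'; rewrite /delta1cl_fun lie_linearl !linearP /= act_linearl.
  by rewrite opprD -scalerN !scalerDr [X in X + _ = _]addrACA [LHS]addrACA.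
have A x y : delta1cl_fun psi y x = - delta1cl_fun psi x y.
  by rewrite /delta1cl_fun lie_anti linearN !opprD opprK [- _ + _]addrC.
split=> // [x a y y'|x].
  by rewrite A H opprD -scalerN -!A.
by rewrite /delta1cl_fun liexx linear0 addNr addr0.
Qed.

Definition delta1cl psi : C2cl := MkC2cl (delta1cl_subproof psi).

Fact delta1cl_linear : linear delta1cl.
Proof.
move=> a f g; apply: val_inj; apply/funext => x; apply/funext => y.
have E z : (a *: f + g) z = a *: f z + g z by [].
rewrite linearP /= -[RHS]/(a *: delta1cl_fun f x y + delta1cl_fun g x y).
rewrite /delta1cl_fun !E !linearP /= !scalerDr.
by rewrite [X in X + _ = _]addrACA [LHS]addrACA.
Qed.
HB.instance Definition _ :=
  GRing.isLinear.Build F {linear L -> M} C2cl *:%R delta1cl delta1cl_linear.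

(* act_word [:: x_1; ...; x_k] m = x_k ... x_1 m: the last letter acts last. *)
Definition act_word (s : seq L) (m : M) : M := foldl (fun m' x => act x m') m s.

End Classical.
Arguments delta0 {F L} M.
Arguments delta1cl {F L} M.

Section Restricted.
Variables (F : fieldType) (p : nat) (L : restrictedLieAlgType F p).
Variable (M : restrictedModType L).
Implicit Types (psi : {linear L -> M}) (phi : C2cl M) (omega : L -> M).

(* With s = [:: g_1; ...; g_p], the letter g_(p - k) is s`_(p - k - 1), and
   g_p ... g_(p - k + 1) is the action of drop (p - k) s. *)
Definition star_term phi (s : seq L) : M :=
  \sum_(k < p.-1) (-1) ^+ k *:
    act_word (drop (p - k) s)
      (phi (lie_word (take (p - k - 1) s)) (nth 0 s (p - k - 1))).

Definition star_property phi omega : Prop :=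
  (forall (a : F) x, omega (a *: x) = a ^+ p *: omega x) /\
  (forall x y, omega (x + y) =
     omega x + omega y + word_sum p (fun w => star_term phi (letters x y w))).

Definition star_pred : {pred C2cl M * (L -> M)} :=
  fun c => `[< star_property c.1 c.2 >].

Lemma act_wordP s : linear (@act_word _ _ M s).
Proof.
by elim: s => // x s IH a m m'; rewrite /act_word /= linearP -!/(act_word s _) IH.
Qed.

Lemma iter_act_linear n (x : L) : linear (iter n (@act _ _ M x)).
Proof. by elim: n => // n IH b m m'; rewrite !iterS IH linearP. Qed.

Lemma iter_act0 n (x : L) : iter n (@act _ _ M x) 0 = 0.
Proof. by elim: n => // n IH; rewrite iterS IH linear0. Qed.

Lemma word_sumP (V : lmodType F) a (f g h : seq bool -> V) :
  (forall w, size w = p -> f w = a *: g w + h w) ->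
  word_sum p f = a *: word_sum p g + word_sum p h.
Proof.
move=> E; rewrite /word_sum scaler_sumr -big_split; apply: eq_bigr => w _ /=.
by rewrite E ?size_tuple // scalerDr !scalerA mulrC.
Qed.

Fact star_pred_closed : submod_closed star_pred.
Proof.
split=> [|a [f o] [f' o']]; rewrite !unfold_in.
  apply/asboolP; split=> [a x|x y] /=; first by rewrite scaler0.
  rewrite !add0r; apply/esym; apply: big1 => w _.
  rewrite /star_term big1 ?scaler0 // => k _.
  have -> : act_word (drop (p - k) (letters x y w)) 0 = 0 :> M.
    by elim: (drop _ _) => //= z s IH; rewrite /act_word /= linear0.
  by rewrite scaler0.
move=> /asboolP[/= oZ oD] /asboolP[/= oZ' oD']; apply/asboolP.
have E x : (a *: o + o') x = a *: o x + o' x by [].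
split=> [b x|x y]; rewrite /= !E.
  by rewrite oZ oZ' scalerDr !scalerA mulrC.
rewrite oD oD' (@word_sumP M a (fun w => star_term (a *: f + f') (letters x y w))
  (fun w => star_term f (letters x y w)) (fun w => star_term f' (letters x y w))).
  by rewrite !scalerDr [in RHS](addrACA (a *: o x)) [RHS]addrACA.
move=> w _; rewrite /star_term scaler_sumr -big_split; apply: eq_bigr => k _ /=.
rewrite scalerA mulrC -scalerA -scalerDr -act_wordP; congr (_ *: act_word _ _).
Qed.
HB.instance Definition _ :=
  GRing.isSubmodClosed.Build F (C2cl M * (L -> M))%type star_pred
    star_pred_closed.

Record C2 := MkC2 { C2_val :> C2cl M * (L -> M); _ : C2_val \in star_pred }.
HB.instance Definition _ := [isSub for C2_val].
HB.instance Definition _ := [Choice of C2 by <:].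
HB.instance Definition _ := [SubChoice_isSubLmodule of C2 by <:].

Definition tilde psi (x : L) : M := psi (ppow x) - iter p.-1 (act x) (psi x).

(* A pair (x, m) in L * M acts on N = M * F by (u, t) |-> (x u + t m, 0);
   Jacobson's formula for these operators, evaluated at (0, 1), yields the
   *-property of tilde psi. *)
Let N : lmodType F := (M * F^o)%type.
Definition endo := {linear N -> N}.
HB.instance Definition _ := GRing.Zmodule.on endo.
Definition endo_mul (f g : endo) : endo := f \o g.
Definition endo_one : endo := idfun.
Fact endo_mulA : associative endo_mul.
Proof. by move=> f g h; apply: linear_ext. Qed.
Fact endo_mul1 : left_id endo_one endo_mul.
Proof. by move=> f; apply: linear_ext. Qed.
Fact endo_mulr1 : right_id endo_one endo_mul.
Proof. by move=> f; apply: linear_ext. Qed.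
Fact endo_mulDl : left_distributive endo_mul +%R.
Proof. by move=> f g h; apply: linear_ext. Qed.
Fact endo_mulDr : right_distributive endo_mul +%R.
Proof. by move=> f g h; apply: linear_ext => x; exact: linearD. Qed.
Fact endo_one_neq0 : endo_one != 0.
Proof.
apply/eqP => /(congr1 (fun f : endo => (f (0, 1)).2)) /= /eqP.
by rewrite oner_eq0.
Qed.
HB.instance Definition _ := GRing.Zmodule_isNzRing.Build endo
  endo_mulA endo_mul1 endo_mulr1 endo_mulDl endo_mulDr endo_one_neq0.

Lemma endoD (f g : endo) v : (f + g) v = f v + g v. Proof. by []. Qed.
Lemma endoM (f g : endo) v : (f * g) v = f (g v). Proof. by []. Qed.
Lemma endoN (f : endo) v : (- f) v = - f v. Proof. by []. Qed.
Lemma endo_sum (I : Type) (r : seq I) (P : pred I) (f : I -> endo) v :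
  (\sum_(i <- r | P i) f i) v = \sum_(i <- r | P i) f i v.
Proof. by elim/big_rec2: _ => // i y f' _ <-. Qed.
Lemma endoMn (f : endo) n v : (f *+ n) v = f v *+ n.
Proof. by elim: n => // n IH; rewrite !mulrS endoD IH. Qed.

Definition aug_fun (x : L) (m : M) (v : N) : N := (act x v.1 + (v.2 : F) *: m, 0).
Fact aug_fun_linear x m : linear (aug_fun x m).
Proof.
move=> a [u s] [v t]; congr pair; rewrite /= ?scaler0 ?addr0 //.
by rewrite linearP scalerDl scalerDr addrACA scalerA.
Qed.
HB.instance Definition _ x m :=
  GRing.isLinear.Build F N N *:%R (aug_fun x m) (aug_fun_linear x m).
Definition aug_op x m : endo := aug_fun x m.

Lemma aug_opD x y m m' : aug_op (x + y) (m + m') = aug_op x m + aug_op y m'.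
Proof.
apply: linear_ext => [[u s]]; congr pair; rewrite /= ?addr0 //.
by rewrite actDl scalerDr addrACA.
Qed.

Lemma aug_op_comm x y m m' :
  ring_lie (aug_op x m) (aug_op y m') = aug_op (lie x y) (act x m' - act y m).
Proof.
apply: linear_ext => [[u s]]; congr pair; rewrite /= ?subr0 //.
rewrite act_lie !scale0r !addr0 !linearD /= !linearZ /=.
by rewrite addrACA.
Qed.

Lemma aug_opX x m n : (aug_op x m ^+ n.+1) (0, 1) = (iter n (act x) m, 0).
Proof.
elim: n => [|n IH].
  by rewrite expr1 /= /aug_fun /= linear0 add0r scale1r.
by rewrite exprS endoM IH /= /aug_fun /= scale0r addr0.
Qed.

Definition alt_sum phi (s : seq L) : M :=
  \sum_(k < (size s).-1) (-1) ^+ k *: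
    act_word (drop (size s - k) s)
      (phi (lie_word (take (size s - k - 1) s)) (nth 0 s (size s - k - 1))).

Lemma star_termE phi s : size s = p -> star_term phi s = alt_sum phi s.
Proof. by rewrite /star_term /alt_sum => ->. Qed.

Lemma alt_sum_rcons phi x s y :
  alt_sum phi (rcons (x :: s) y) =
  phi (lie_word (x :: s)) y - act y (alt_sum phi (x :: s)).
Proof.
rewrite /alt_sum size_rcons /=; set n := (size s).+1.
rewrite big_ord_recl /= expr0 scale1r drop_oversize ?size_rcons //.
rewrite -cats1 take_size_cat // nth_cat ltnn subnn /=; congr (_ + _).
rewrite linear_sum -sumrN; apply: eq_bigr => k _.
rewrite linearZ /= /bump add1n exprS mulN1r scaleNr; congr (- (_ *: _)).
have [n' nE] : exists n', (n - k = n'.+1)%N.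
  by exists (size s - k)%N; rewrite /n subSn // ltnW.
have ltn' : (n' < n)%N by rewrite -nE leq_subr.
rewrite subSS nE subn1 /= -cat_cons take_cat nth_cat /= ltn'.
have -> : drop n' (s ++ [:: y]) = drop n' s ++ [:: y].
  have [lt|-> ] : (n' < size s)%N \/ n' = size s by move: ltn'; rewrite ltnS leq_eqVlt => /orP[/eqP|]; auto.
    by rewrite drop_cat lt.
  by rewrite drop_cat ltnn subnn drop_size.
by rewrite /act_word foldl_cat.
Qed.

Lemma aug_op_word psi x s :
  foldl (@ring_lie _) (aug_op x (psi x)) [seq aug_op y (psi y) | y <- s] =
  aug_op (lie_word (x :: s)) (psi (lie_word (x :: s)) - alt_sum (delta1cl M psi) (x :: s)).
Proof.
elim/last_ind: s => [|s y IH].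
  by rewrite /alt_sum big_ord0 subr0.
rewrite map_rcons -cats1 foldl_cat IH /= aug_op_comm -rcons_cons alt_sum_rcons.
rewrite /lie_word /= -cats1 foldl_cat /=; congr aug_op.
rewrite linearB /= opprD opprK /delta1cl_fun.
rewrite [in RHS]opprD opprK [in RHS](opprD (_ + _ : M)) [in RHS]addrA [in RHS]addrCA.
by rewrite subrr addr0 opprD opprK addrA.
Qed.


Variable charFp : p \in [pchar F].

Lemma endo_char : p \in [pchar endo].
Proof.
apply/andP; split; first exact: pcharf_prime charFp.
apply/eqP; apply: linear_ext => v.
by rewrite endoMn -scaler_nat (pcharf0 charFp) scale0r.
Qed.

Fact tilde_star psi : (delta1cl M psi, tilde psi) \in star_pred.
Proof.
have p_pr := pcharf_prime charFp.
have pE : p = p.-1.+1 by rewrite prednK // prime_gt0.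
rewrite unfold_in; apply/asboolP; split=> [a x|x y] /=.
  rewrite /tilde ppowZ !linearZ /= scalerBr; congr (_ - _).
  have -> n m : iter n (act (a *: x)) m = a ^+ n *: iter n (act x) m.
    elim: n => [|n IH]; first by rewrite expr0 scale1r.
    by rewrite !iterS IH linearZ /= exprSr -scalerA actZl.
  have := iter_act_linear p.-1 x a (psi x) 0.
  by rewrite iter_act0 !addr0 => ->; rewrite scalerA -exprSr -pE.
have [P [PD PE]] := jacobson endo_char (aug_op x (psi x)) (aug_op y (psi y)).
move: PD => /(congr1 (fun f : endo => (f (0, 1)).1)).
have aug_opXp z m : (aug_op z m ^+ p) (0, 1) = (iter p.-1 (act z) m, 0).
  by have := aug_opX z m p.-1; rewrite -pE.
rewrite -aug_opD -linearD !endoD endo_sum !aug_opXp /= => PD.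
have {}PD : iter p.-1 (act (x + y)) (psi (x + y)) =
    iter p.-1 (act x) (psi x) + iter p.-1 (act y) (psi y) +
    word_sum p (fun w => psi (lie_word (letters x y w)) -
                        star_term (delta1cl M psi) (letters x y w)).
  rewrite PD; congr (_ + _); transitivity (\sum_(1 <= i < p) (P i (0, 1)).1).
    by elim/big_rec2: _ => //= i u v _ <-.
  pose T (w : p.-tuple bool) := take 2 w == [:: true; false].
  pose G (w : seq bool) := psi (lie_word (letters x y w)) -
                           star_term (delta1cl M psi) (letters x y w).
  have countT w : T w -> (1 <= count id w < p)%N.
    rewrite /T; have := size_tuple w; case: (tval w) => [|[] [|[] s]] //= <- _.
    by rewrite !add0n add1n !ltnS count_size.
  have Pi i : (1 <= i < p)%N ->
      (P i (0, 1)).1 = \sum_(w | T w && (count id w == i)) i%:R^-1 *: G w.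
    move=> /[dup] ip /PE /(congr1 (fun f : endo => (f (0, 1)).1)).
    have i_neq0 : i%:R != 0 :> F.
      case/andP: ip => i_gt0 ltip.
      by rewrite -(dvdn_pcharf charFp) gtnNdvd.
    rewrite endoMn endo_sum -scaler_nat /= => E.
    rewrite -[LHS](scalerK i_neq0) E -scaler_sumr; congr (_ *: _).
    transitivity (\sum_(w | T w && (count id w == i)) (match letters (aug_op x (psi x)) (aug_op y (psi y)) w with
       | [::] => 0 : endo
       | c :: s => foldl (ring_lie (S:=endo)) c s
       end (0, 1)).1).
      by elim/big_rec2: _ => //= w u v _ <-.
    apply: eq_bigr => w /andP[/countT]; rewrite /G; have := size_tuple w.
    case: (tval w) => [//|b w'] sz _ _ /=.
    have -> : letters (aug_op x (psi x)) (aug_op y (psi y)) w' =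
              [seq aug_op z (psi z) | z <- letters x y w'].
      by rewrite /letters -map_comp; apply: eq_map => -[].
    have -> : (if b then aug_op x (psi x) else aug_op y (psi y)) =
              aug_op (if b then x else y) (psi (if b then x else y)) by case: b {sz}.
    rewrite aug_op_word /= /aug_fun /= linear0 add0r scale1r; congr (_ - _).
    by apply/esym/star_termE; apply: etrans sz; rewrite /= size_map.
  rewrite (eq_big_nat _ _ Pi) (exchange_big_dep T) /=; last by move=> i w _ /andP[].
  apply: eq_bigr => w Tw; rewrite (eq_bigl (fun i => i == count id w)).
    by rewrite big_nat1_eq countT.
  by move=> i; rewrite Tw eq_sym.
rewrite /tilde PD ppowD !linearD /=.
rewrite [word_sum p (fun w => psi _ - _)](@word_sumP M (-1)
  (fun w => psi (lie_word (letters x y w)) -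
                        star_term (delta1cl M psi) (letters x y w))
  (fun w => star_term (delta1cl M psi) (letters x y w)) (fun w => psi (lie_word (letters x y w)))).
  rewrite scaleN1r opprD opprK addrACA; congr (_ + _); first by rewrite addrACA.
  have -> : psi (word_sum p (fun w => lie_word (letters x y w))) =
            word_sum p (fun w => psi (lie_word (letters x y w))).
    by rewrite /word_sum linear_sum; apply: eq_bigr => w _; rewrite linearZ.
  by rewrite addrC subrK.
by move=> w _; rewrite scaleN1r addrC.
Qed.

Definition delta1 psi : C2 := MkC2 (tilde_star psi).

Fact delta1_linear : linear delta1.
Proof.
move=> a f g; apply: val_inj; rewrite linearP /=.
congr (_, _); first exact: linearP.
have E z : (a *: f + g) z = a *: f z + g z by [].
apply/funext => x; rewrite -[RHS]/(a *: tilde f x + tilde g x) /tilde.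
by rewrite !E iter_act_linear scalerBr opprD addrACA.
Qed.
HB.instance Definition _ :=
  GRing.isLinear.Build F {linear L -> M} C2 *:%R delta1 delta1_linear.
End Restricted.
Arguments delta1 {F p L M} charFp psi.

Definition H1cl (F : fieldType) (L : lieAlgType F) (M : lieModType L) :=
  cohomology (delta0 M) (delta1cl M).
Definition H1 (F : fieldType) (p : nat) (charFp : p \in [pchar F])
  (L : restrictedLieAlgType F p) (M : restrictedModType L) :=
  cohomology (delta0 M) (@delta1 F p L M charFp).

(* Main.v *)
(* Both complexes have the same degree 0, degree 1 and delta0, and delta1cl is
   the first coordinate of delta1, so ker delta1 lies in ker delta1cl and both
   H^1 are quotients by the same coboundaries.  The second coordinate of
   delta1 (delta0 m) at x is x^(p-1) x m - x^[p] m, which vanishes because M is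
   restricted. *)
Require Import Defs.
From HB Require Import structures.
From mathcomp Require Import all_boot all_order all_algebra.
From mathcomp Require Import generic_quotient boolp.
Import GRing.Theory.
Local Open Scope ring_scope.

Section CohomologyInclusion.
Set Implicit Arguments.
Unset Strict Implicit.
Variables (R : comNzRingType) (A B C C' : lmodType R) (d : {linear A -> B}).
Variables (d1 : {linear B -> C}) (d2 : {linear B -> C'}).
Hypothesis ker_d1_d2 : forall x, d1 x = 0 -> d2 x = 0.

Lemma cocycle_incl_subproof (z : cocycle d1) : val z \in cocycle_pred d2.
Proof. by have /eqP dz := valP z; apply/eqP; apply: ker_d1_d2. Qed.

Definition cocycle_incl (z : cocycle d1) : cocycle d2 :=
  Cocycle (cocycle_incl_subproof z).

(** Computed on the chosen representative [repr u]; independence of this choice is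
    [coh_incl_class]. *)
Definition coh_incl (u : cohomology d d1) : cohomology d d2 :=
  coh_class d (cocycle_incl (repr u)).

(** Two representatives of a class differ by some [d x]. The inclusion keeps the underlying element
    of [B] and both quotients use the same [d], so the images differ by the same [d x]. *)
Lemma coh_incl_class (z : cocycle d1) :
  coh_incl (coh_class d z) = coh_class d (cocycle_incl z).
Proof.
by apply/coh_classP; apply/(coh_classP d (repr (coh_class d z))); exact: reprK.
Qed.

Lemma coh_incl_linear : linear coh_incl.
Proof.
move=> a; elim/coh_ind => z; elim/coh_ind => z'.
rewrite -linearP !coh_incl_class -linearP; congr coh_class; exact: val_inj.
Qed.

HB.instance Definition _ := GRing.isLinear.Build R
  (cohomology d d1) (cohomology d d2) *:%R coh_incl coh_incl_linear.

Lemma coh_incl_inj : injective coh_incl.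
Proof.
elim/coh_ind => z; elim/coh_ind => z'; rewrite !coh_incl_class.
(* Both equalities of classes unfold to the same condition, that [val z - val z'] is a value of
   [d]. *)
by move=> /coh_classP zz'; apply/coh_classP.
Qed.
End CohomologyInclusion.

(** [delta0] already applies x once, hence the exponent n + 1; n = p - 1 gives the p-th power that
    [act_ppow] compares with. *)
Lemma iter_delta0 (F : fieldType) (L : lieAlgType F) (M : lieModType L)
    (m : M) (x : L) n : iter n (act x) (delta0 M m x) = - iter n.+1 (act x) m.
Proof. by elim: n => //= n ->; rewrite linearN. Qed.

Lemma delta1cl_delta0 (F : fieldType) (L : lieAlgType F) (M : lieModType L)
    (m : M) : delta1cl M (delta0 M m) = 0.
Proof.
apply: val_inj; apply/funext => x; apply/funext => y.
(* The first two terms give xym - yxm, and [act_lie] turns -[x,y]m into its opposite. *)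
rewrite /= /delta1cl_fun /= /delta0_fun act_lie !linearN opprK.
exact: subrr.
Qed.

Lemma tilde_delta0 (F : fieldType) (p : nat) (L : restrictedLieAlgType F p)
    (M : restrictedModType L) (m : M) (x : L) :
  (0 < p)%N -> tilde (delta0 M m) x = 0.
Proof.
move=> p_gt0; rewrite /tilde iter_delta0 prednK // opprK /= /delta0_fun.
by rewrite act_ppow addNr.
Qed.

Lemma delta1_delta0 (F : fieldType) (p : nat) (charFp : p \in [pchar F])
    (L : restrictedLieAlgType F p) (M : restrictedModType L) (m : M) :
  delta1 charFp (delta0 M m) = 0.
Proof.
apply: val_inj; congr pair; first exact: delta1cl_delta0.
apply/funext => x; apply: tilde_delta0.
exact/prime_gt0/(pcharf_prime charFp).
Qed.

(** The inclusion of kernels from which [coh_incl] builds [Phi]. *)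
Lemma delta1_eq0_cl (F : fieldType) (p : nat) (charFp : p \in [pchar F])
    (L : restrictedLieAlgType F p) (M : restrictedModType L)
    (psi : {linear L -> M}) :
  delta1 charFp psi = 0 -> delta1cl M psi = 0.
Proof. by move=> /(congr1 (fun c => (val c).1)). Qed.

Theorem theorem3p9 (F : fieldType) (p : nat) (charFp : p \in [pchar F])
    (L : restrictedLieAlgType F p) (M : restrictedModType L) :
  (forall m : M, delta1 charFp (delta0 M m) = 0) /\
  exists Phi : {linear H1 charFp M -> H1cl M},
    injective Phi /\
    forall z : cocycle (@delta1 F p L M charFp),
      exists2 zcl : cocycle (delta1cl M),
        val zcl = val z &
        Phi (coh_class (delta0 M) z) = coh_class (delta0 M) zcl.
Proof.
split; first exact: delta1_delta0.
have ker := @delta1_eq0_cl F p charFp L M.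
exists (coh_incl (d := delta0 M) ker).
split=> [|z]; first exact: coh_incl_inj.
by exists (cocycle_incl ker z); last exact: coh_incl_class.
Qed.
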